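(* Let $(X,d)$ be a $K$-quasi-metric space with infinitely remote set $X_\infty=\{\infty\}$. Let $\lambda:X\to[0,\infty]$, $L>0$ and $K'\ge K$ be such that $X_\infty=\lambda^{-1}(\infty)$ and, for all $x,y\in X$ for which $d(x,y)$ is defined, $$d(x,y)\le K'\max\{L\lambda(x),L\lambda(y)\},\qquad L\lambda(x)\le K'\max\{d(x,y),L\lambda(y)\}.$$ Put $X'_\infty:=\lambda^{-1}(0)$ and define $d_\lambda:(X\times X)\setminus(X'_\infty\times X'_\infty)\to[0,\infty]$ by (1) $d_\lambda(x,y):=\frac{d(x,y)}{\lambda(x)\lambda(y)}$ for $x,y\in X\setminus(X'_\infty\cup X_\infty)$; (2) $d_\lambda(x,\infty):=d_\lambda(\infty,x):=\frac{L}{\lambda(x)}$ for $x\in X\setminus(X'_\infty\cup X_\infty)$; (3) $d_\lambda(\infty,\infty):=0$; (4) $d_\lambda(x,p):=d_\lambda(p,x):=\infty$ for $p\in X'_\infty$ and $x\in X\setminus X'_\infty$. If $(X,d)$ is doubling with constant $D$, then $(X,d_\lambda)$ is doubling with constant at most $D^{\lceil\log_2(8K'^{10}K)\rceil}+1$.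
   Context: A \emph{$K$-quasi-metric space} with infinitely remote set $X_\infty\subset X$ is a set $X$ with a function $d:(X\times X)\setminus(X_\infty\times X_\infty)\to[0,\infty]$ satisfying, whenever the distances involved are defined: (1) $d(x,y)=0\iff x=y$; (2) $d(x,y)=d(y,x)$; (3) $d(x,y)\le K\max\{d(x,z),d(z,y)\}$ for all $x,y,z\in X$ for which all distances are defined; (4) $d(x,y)<\infty\iff x,y\in X\setminus X_\infty$. A quasi-metric space is \emph{doubling with constant $D$} if every ball of finite radius can be covered by at most $D$ balls of half the radius. Balls are closed: the ball of radius $r$ around $x$ is $\{y\in X : d(x,y)\le r\}$ for $x$ outside the infinitely remote set; a ball of finite radius centred at an infinitely remote point consists of that point only. For $d_\lambda$ the infinitely remote set is $X'_\infty$.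
   Formalization: The exponent is taken as max(0, ⌈log₂(8K'^10 K)⌉); this differs from the stated ceiling only when K < 1, which forces X to have at most one point besides ∞, where a negative exponent can make the claim false. *)

(* Defs.v *)
From HB Require Import structures.
From mathcomp Require Import all_boot all_order all_algebra.
From mathcomp Require Import all_classical all_reals all_analysis.

Set Implicit Arguments.
Unset Strict Implicit.
Unset Printing Implicit Defensive.

Import Order.TTheory GRing.Theory Num.Theory.

Local Open Scope classical_set_scope.
Local Open Scope ring_scope.
Local Open Scope ereal_scope.

(* A partial distance on (X x X) \ (Xinf x Xinf) is encoded as a total function
   X -> X -> \bar R; its values on Xinf x Xinf are irrelevant, and every
   condition below is restricted to pairs in this domain. *)
Definition dist_defined (X : Type) (Xinf : set X) (x y : X) : Prop :=
  ~ (Xinf x /\ Xinf y).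

Record quasi_metric (R : realType) (X : Type) (K : R) (Xinf : set X)
    (d : X -> X -> \bar R) : Prop := QuasiMetric {
  qm_ge0 : forall x y, dist_defined Xinf x y -> 0 <= d x y ;
  qm_eq0 : forall x y, dist_defined Xinf x y -> (d x y = 0 <-> x = y) ;
  qm_sym : forall x y, dist_defined Xinf x y -> d x y = d y x ;
  qm_tri : forall x y z,
    dist_defined Xinf x y -> dist_defined Xinf x z -> dist_defined Xinf z y ->
    d x y <= K%:E * maxe (d x z) (d z y) ;
  qm_fin : forall x y, dist_defined Xinf x y ->
    (d x y < +oo <-> ~ Xinf x /\ ~ Xinf y) }.

Definition qball (R : realType) (X : Type) (Xinf : set X)
    (d : X -> X -> \bar R) (x : X) (r : R) : set X :=
  if x \in Xinf then [set x] else [set y | d x y <= r%:E].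

(* The constant D is allowed to be any real number, so that it can bound the
   number n of balls without being an integer itself. *)
Definition doubling (R : realType) (X : Type) (Xinf : set X)
    (d : X -> X -> \bar R) (D : R) : Prop :=
  forall (x : X) (r : R), (0 <= r)%R ->
    exists (n : nat) (c : 'I_n -> X), (n%:R <= D)%R /\
      qball Xinf d x r `<=` \bigcup_i qball Xinf d (c i) (r / 2)%R.

(* On pairs of points of lam^-1(0), where d_lambda is undefined, the value is
   the junk value +oo. *)
Definition d_lambda (R : realType) (X : Type) (infty : X)
    (d : X -> X -> \bar R) (lam : X -> \bar R) (L : R) (x y : X) : \bar R :=
  let Xinf' := lam @^-1` [set 0] in
  if (x \in Xinf') || (y \in Xinf') then +oo
  else if `[< x = infty >] then
    if `[< y = infty >] then 0 else L%:E / lam y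
  else if `[< y = infty >] then L%:E / lam x
  else d x y / (lam x * lam y).

(* Main.v *)
(* Away from the points y with lam y >= 2L/r, which lie in the d_lambda-ball of
   radius r/2 around infty, every point y of a d_lambda-ball of radius r around
   x satisfies lam y >= m/K' with m = min(lam x, L/r) (m = L/r if x = infty),
   and these points lie in a single d-ball of radius 2K'rm^2. Since the lower
   bound on lam makes d_lambda at most (K'/m)^2 d there, halving the d-ball
   until 2^k >= 4K'^3K produces pieces of d_lambda-radius at most r/2. *)

Require Import Defs.
From HB Require Import structures.
From mathcomp Require Import all_boot all_order all_algebra.
From mathcomp Require Import all_classical all_reals all_analysis.
From mathcomp Require Import ring lra.

Set Implicit Arguments.
Unset Strict Implicit.
Unset Printing Implicit Defensive.

Import Order.TTheory GRing.Theory Num.Theory.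

Local Open Scope classical_set_scope.
Local Open Scope ring_scope.

(** [doubling] unfolds to this predicate for the family [qball Xinf d ^~ (r / 2)]; keeping the
    family abstract lets covers by balls of two distances be combined. *)
Definition covered_by (R : realType) (I T : Type) (F : I -> set T)
    (A : set T) (N : R) : Prop :=
  exists n (c : 'I_n -> I), n%:R <= N /\ A `<=` \bigcup_i F (c i).

Lemma covered_by_sub (R : realType) (I T : Type) (F : I -> set T)
    (A B : set T) (M N : R) :
  A `<=` B -> M <= N -> covered_by F B M -> covered_by F A N.
Proof.
move=> AB MN [n [c [nM Bc]]]; exists n, c; split; first exact: le_trans nM MN.
exact: subset_trans AB Bc.
Qed.

Lemma covered_by1 (R : realType) (I T : Type) (F : I -> set T)
    (A : set T) (i : I) : A `<=` F i -> covered_by F A (1 : R).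
Proof. by move=> AF; exists 1%N, (fun=> i); split=> // x /AF; exists ord0. Qed.

Lemma covered_by0 (R : realType) (I T : Type) (F : I -> set T) :
  covered_by F set0 (0 : R).
Proof. 
by exists 0%N, (fun j : 'I_0 => False_rect I (notF (ltn_ord j))); split. Qed.

Lemma covered_byU (R : realType) (I T : Type) (F : I -> set T)
    (A B : set T) (M N : R) :
  covered_by F A M -> covered_by F B N -> covered_by F (A `|` B) (M + N).
Proof.
move=> [m [a [mM Aa]]] [n [b [nN Bb]]].
exists (m + n)%N,
  (fun i => match fintype.split i with inl j => a j | inr j => b j end).
split; first by rewrite natrD lerD.
move=> x [/Aa [i _ Fx]|/Bb [i _ Fx]].
  by exists (lshift n i) => //; rewrite (unsplitK (inl i)).
by exists (rshift m i) => //; rewrite (unsplitK (inr i)).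
Qed.

(** The pieces are cut down to [A] because, when recentring, the two distances can be compared only
    at points of [A]. *)
Lemma covered_by_trans (R : realType) (I J T : Type) (F : I -> set T)
    (G : J -> set T) (A : set T) (M N : R) : 0 <= N ->
  covered_by F A M -> (forall i, covered_by G (A `&` F i) N) ->
  covered_by G A (M * N).
Proof.
move=> N0 [n [c [nM Ac]]] FG.
suff: covered_by G (A `&` \bigcup_i F (c i)) (n%:R * N).
  apply: covered_by_sub; last exact: ler_wpM2r.
  by move=> x Ax; split=> //; exact: Ac.
elim: n c {nM Ac} => [|n IH] c.
  rewrite mul0r; apply: covered_by_sub (covered_by0 R G) => //.
  by move=> x [_ [[]]].
rewrite -natr1 mulrDl mul1r.
apply: covered_by_sub (covered_byU (IH (c \o lift ord_max)) (FG (c ord_max))) => //.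
move=> x [Ax [i _ Fx]]; case: (unliftP ord_max i) Fx => [j ->|->] Fx; last by right.
by left; split=> //; exists j.
Qed.

(** The ball around an infinitely remote point contains that point, so its cover has at least one
    member. *)
Lemma doubling_ge1 (R : realType) (X : Type) (Xinf : set X)
    (d : X -> X -> \bar R) (D : R) (x : X) :
  Xinf x -> doubling Xinf d D -> 1 <= D.
Proof.
move=> Xx /(_ x 0 (lexx _))[n [c [nD /(_ x)[]]]]; first by rewrite /qball mem_set.
move=> i _ _; apply: le_trans nD; rewrite ler1n.
by case: n i {c} => // -[].
Qed.

Lemma doubling_iter (R : realType) (X : Type) (Xinf : set X)
    (d : X -> X -> \bar R) (D : R) (k : nat) (x : X) (r : R) :
  0 <= D -> doubling Xinf d D -> 0 <= r ->
  covered_by (qball Xinf d ^~ (r / 2 ^+ k)) (qball Xinf d x r) (D ^+ k).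
Proof.
move=> D0 dD r0; elim: k => [|k IH].
  by rewrite !expr0 divr1; exact: (@covered_by1 _ _ _ _ _ x).
rewrite [D ^+ _]exprSr; apply: (covered_by_trans D0 IH) => y.
have rk0 : 0 <= r / 2 ^+ k by rewrite divr_ge0 ?exprn_ge0.
have := dD y _ rk0; rewrite -mulrA -invfM -exprSr.
by apply: covered_by_sub => // z [].
Qed.

(* The two distances share no ball, so a cover by d-balls is turned into one by
   d'-balls by recentring each d-ball that meets A at a point of A. *)
Lemma covered_by_recentred (R : realType) (X : Type) (Xinf Xinf' : set X)
    (d d' : X -> X -> \bar R) (K D rho s : R) (k : nat) (A : set X) (c : X) :
  0 <= K -> 0 <= D -> 0 <= rho -> quasi_metric K Xinf d -> doubling Xinf d D ->
  (forall y, A y -> ~ Xinf y) -> (forall y, A y -> ~ Xinf' y) ->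
  A `<=` qball Xinf d c rho ->
  (forall y z, A y -> A z ->
     (d y z <= (K * (rho / 2 ^+ k))%:E)%E -> (d' y z <= s%:E)%E) ->
  covered_by (qball Xinf' d' ^~ s) A (D ^+ k).
Proof.
move=> K0 D0 rho0 dqm dD AXinf AXinf' Ac dd'.
rewrite -[D ^+ k]mulr1.
apply: (covered_by_trans ler01 (M := D ^+ k)
  (F := qball Xinf d ^~ (rho / 2 ^+ k))).
  exact: covered_by_sub (doubling_iter k c D0 dD rho0).
move=> b.
have [[y [Ay yb]]|empty] := pselect (exists y,
    (A `&` qball Xinf d b (rho / 2 ^+ k)) y);
  last first.
  apply: covered_by_sub (covered_by0 R _) => // z Az.
  by apply: empty; exists z.
apply: (@covered_by1 _ _ _ _ _ y) => z [Az zb].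
rewrite /qball memNset; last exact: AXinf'.
rewrite /=; apply: dd' => //.
have nXy := AXinf _ Ay; have nXz := AXinf _ Az.
(* An infinitely remote [b] is alone in its ball, which would force [y = b], whereas [A] avoids
   [Xinf]. *)
move: yb zb; rewrite /qball; have [bX|bX] := boolP (b \in Xinf) => /=.
  by move=> yb; case: nXy; rewrite yb; exact: set_mem.
have nXb : ~ Xinf b by move=> Xb; rewrite mem_set in bX.
move=> yb zb.
(* Going through the old centre [b] costs the factor [K] that appears in the assumption on [d']. *)
apply: (le_trans (qm_tri dqm (z := b) _ _ _)); rewrite /dist_defined; try tauto.
rewrite EFinM; apply: lee_wpmul2l; first by rewrite lee_fin.
rewrite ge_max zb andbT (qm_sym dqm) // /dist_defined; tauto.
Qed.

(** The quotient of logarithms is the logarithm to base 2; truncating its ceiling at 0 yields a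
    natural number of halvings. *)
Lemma exponent_bound (R : realType) (a : R) : 1 <= a ->
  exists2 k : nat,
    Num.max 0%R (Num.ceil (ln a / ln 2)) = k%:Z & a <= 2 ^+ k.
Proof.
move=> a1; exists `|Num.max 0%R (Num.ceil (ln a / ln 2))|%N.
  by rewrite gez0_abs // le_max lexx.
have ln2 : 0 < ln (2 : R) by rewrite ln_gt0 ?ltr1n.
set e := Num.max _ _.
have e0 : 0 <= e by rewrite le_max lexx.
have a0 : 0 < a := lt_le_trans ltr01 a1.
rewrite -ler_ln ?posrE ?exprn_gt0 // lnXn // -[leRHS]mulr_natr [leRHS]mulrC -ler_pdivrMr //.
apply: le_trans (ceil_ge _) _.
by rewrite natr_absz ger0_norm // ler_int le_max lexx orbT.
Qed.

(** The triangle inequality through [x] itself reads d(x,y) <= K max(0, d(x,y)), and 0 < d(x,y) <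
    +oo can be cancelled. *)
Lemma quasi_metric_K_ge1 (R : realType) (X : Type) (K : R) (Xinf : set X)
    (d : X -> X -> \bar R) (x y : X) :
  quasi_metric K Xinf d -> ~ Xinf x -> ~ Xinf y -> x <> y -> 1 <= K.
Proof.
move=> dqm nx ny xy.
have dxy : dist_defined Xinf x y by case.
have dxx : dist_defined Xinf x x by case.
have := qm_tri dqm dxy dxx dxy.
have -> : d x x = 0%E by apply/(qm_eq0 dqm dxx).
have d_neq0 : d x y <> 0%E by move/(qm_eq0 dqm dxy).
have dgt : (0 < d x y)%E.
  by rewrite lt_neqAle (qm_ge0 dqm dxy) andbT eq_sym; exact/eqP.
have : (d x y < +oo)%E by apply/(qm_fin dqm dxy).
case: (d x y) dgt {d_neq0} => [r| |] //; rewrite lte_fin => r0 _.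
rewrite (max_r (ltW _)) ?lte_fin // -EFinM lee_fin -{1}[r]mul1r.
by rewrite ler_pM2r.
Qed.

(* [Num.max 0] only matters when K < 1, which forces X to have at most one
   point other than infty; then a negative exponent would make the bound
   false. As soon as K >= 1 the exponent is the plain ceiling. *)
Theorem proposition5 (R : realType) (X : Type) (infty : X)
    (d : X -> X -> \bar R) (lam : X -> \bar R) (K K' L D : R)
    (d_qm : quasi_metric K [set infty] d)
    (lam_ge0 : forall x, (0 <= lam x)%E)
    (L_gt0 : 0 < L)
    (leKK' : K <= K')
    (lam_infty : [set infty] = lam @^-1` [set +oo%E])
    (d_le : forall x y, dist_defined [set infty] x y ->
      (d x y <= K'%:E * maxe (L%:E * lam x) (L%:E * lam y))%E)
    (lam_le : forall x y, dist_defined [set infty] x y ->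
      (L%:E * lam x <= K'%:E * maxe (d x y) (L%:E * lam y))%E)
    (d_doubling : doubling [set infty] d D) :
  doubling (lam @^-1` [set 0%E]) (d_lambda infty d lam L)
    (D ^ (Num.max 0 (Num.ceil (ln (8 * K' ^+ 10 * K) / ln 2))) + 1).

Proof.
set Z := lam @^-1` [set 0%E]; set dl := d_lambda _ _ _ _.
have lamy x : lam x = +oo%E <-> x = infty.
  by move/seteqP: lam_infty => [s1 s2]; split=> [/s2//|->]; exact: s1.
(* Away from [infty] both [lam] and [d] are finite, so the estimates can be carried out in [R]. *)
pose l x := fine (lam x); pose e x y := fine (d x y).
have lamE x : x <> infty -> lam x = (l x)%:E.
  move=> xi; rewrite fineK // fin_numE -ltNye.
  rewrite (lt_le_trans (ltNyr 0) (lam_ge0 x)) /=.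
  by apply/eqP => /lamy.
have defd x y : x <> infty -> dist_defined [set infty] x y by move=> xi [].
have dE x y : x <> infty -> y <> infty -> d x y = (e x y)%:E.
  move=> xi yi; rewrite fineK // ge0_fin_numE ?(qm_ge0 d_qm) //; last exact: defd.
  by apply/(qm_fin d_qm); [exact: defd|split].
have e_ge0 x y : x <> infty -> y <> infty -> 0 <= e x y.
  by move=> xi yi; rewrite -lee_fin -dE // (qm_ge0 d_qm) //; exact: defd.
have nZinf : ~ Z infty by rewrite /Z /=; move/lamy: (erefl infty) => ->.
have l_gt0 x : x <> infty -> ~ Z x -> 0 < l x.
  move=> xi; rewrite /Z /= lamE // => lx.
  rewrite lt_neqAle -lee_fin -lamE // lam_ge0 andbT.
  by apply/eqP => l0; apply: lx; rewrite -l0.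
have eL x y : x <> infty -> y <> infty ->
    e x y <= K' * Num.max (L * l x) (L * l y).
  move=> xi yi; have := d_le x y (defd x y xi).
  by rewrite dE // !lamE // -!EFinM -EFin_max -EFinM lee_fin.
have Le x y : x <> infty -> y <> infty ->
    L * l x <= K' * Num.max (e x y) (L * l y).
  move=> xi yi; have := lam_le x y (defd x y xi).
  by rewrite dE // !lamE // -!EFinM -EFin_max -EFinM lee_fin.
have dlZ x y : Z y -> dl x y = +oo%E.
  by move=> Zy; rewrite /dl /d_lambda (mem_set Zy) orbT.
have dlE x y : x <> infty -> y <> infty -> ~ Z x -> ~ Z y ->
    dl x y = (e x y / (l x * l y))%:E.
  move=> xi yi Zx Zy; rewrite /dl /d_lambda !memNset //= !asboolF // dE //.
  rewrite !lamE // -EFinM inver mulf_eq0 !gt_eqF ?l_gt0 //.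
have dly y : y <> infty -> ~ Z y -> dl infty y = (L / l y)%:E.
  move=> yi Zy; rewrite /dl /d_lambda !memNset //= asboolT // asboolF //.
  by rewrite lamE // inver gt_eqF ?l_gt0.
have dlyr y : y <> infty -> ~ Z y -> dl y infty = (L / l y)%:E.
  move=> yi Zy; rewrite /dl /d_lambda !memNset //= asboolF // asboolT //.
  by rewrite lamE // inver gt_eqF ?l_gt0.
have dlii : dl infty infty = 0%E.
  by rewrite /dl /d_lambda !memNset //= asboolT.
have e_eq0 x y : x <> infty -> y <> infty -> e x y = 0 <-> x = y.
  move=> xi yi; rewrite -(qm_eq0 d_qm (defd x y xi)) dE //.
  by split=> [->|[->]].
have ball_center x s : 0 <= s -> qball Z dl x s x.
  move=> s0; rewrite /qball; case: ifPn => // /negP Zx /=.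
  have {}Zx : ~ Z x by move=> /mem_set.
  have [->|xi] := pselect (x = infty); first by rewrite dlii lee_fin.
  by rewrite dlE // (e_eq0 x x xi xi).2 // mul0r lee_fin.
have D1 : 1 <= D by apply: doubling_ge1 d_doubling.
have D0 : 0 <= D by lra.
move=> x r r0.
set E := D ^ _ + 1.
(* This leaves room for the one or two balls used in the degenerate cases. *)
have E2 : 2 <= E.
  rewrite /E; set a := Num.max _ _.
  have : 0 <= a by rewrite le_max lexx.
  case: a => // n _.
  suff : 1 <= D ^ n by lra.
  exact: (exprn_ege1 n D1).
have r20 : 0 <= r / 2 by lra.
have E1 : 1 <= E by lra.
change (covered_by (qball Z dl ^~ (r / 2)) (qball Z dl x r) E).
have [Zx|nZx] := pselect (Z x).
  apply: (covered_by_sub _ E1 (@covered_by1 _ _ _ _ (qball Z dl x r) x _)) => //.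
  by rewrite /qball (mem_set Zx).
have ballE y : qball Z dl x r y = (dl x y <= r%:E)%E.
  by rewrite /qball memNset //=.
have ballZ y : qball Z dl x r y -> ~ Z y.
  by rewrite ballE => xy /(dlZ x) xyy; rewrite xyy in xy.
have [K_lt1|K1] := ltP K 1.
  have uniq y z : y <> infty -> z <> infty -> y = z.
    move=> yi zi; apply: contrapT => yz.
    by have := quasi_metric_K_ge1 d_qm yi zi yz; lra.
  apply: (covered_by_sub (B := [set infty] `|` [set y | y <> infty]) _ E2).
    by move=> y _; have [|] := pselect (y = infty); [left|right].
  apply: covered_byU.
    by apply: (@covered_by1 _ _ _ _ _ infty) => y ->; exact: ball_center.
  have [[a ai]|noa] := pselect (exists a, a <> infty).
    apply: (@covered_by1 _ _ _ _ _ a) => y yi.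
    by rewrite (uniq y a yi ai); exact: ball_center.
  by apply: covered_by_sub ler01 (covered_by0 _ _) => y yi; apply: noa; exists y.
have K'1 : 1 <= K' by lra.
(* Radius 0 is treated apart since [L / r] is used below; such a ball is just its centre. *)
have [r_eq0|r_neq0] := eqVneq r 0.
  apply: covered_by_sub (fun y yE => yE) E1 _.
  apply: (@covered_by1 _ _ _ _ _ x) => y xy.
  suff yx : y = x by rewrite yx; exact: ball_center.
  have Zy := ballZ _ xy; move: xy; rewrite ballE r_eq0.
  have [->|xi] := pselect (x = infty); have [->|yi] := pselect (y = infty) => //.
  - by rewrite dly // lee_fin leNgt divr_gt0 // l_gt0.
  - by rewrite dlyr // lee_fin leNgt divr_gt0 // l_gt0.
  rewrite dlE // lee_fin ler_pdivrMr ?mulr_gt0 ?l_gt0 // mul0r => exy.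
  by apply/esym/e_eq0 => //; apply/eqP; rewrite eq_le exy e_ge0.
have {r_neq0}r_gt0 : 0 < r by rewrite lt_neqAle eq_sym r_neq0.
have K'10 : 1 <= K' ^+ 10 by exact: exprn_ege1.
have [k kE kK] : exists2 k : nat,
    Num.max 0%R (Num.ceil (ln (8 * K' ^+ 10 * K) / ln 2)) = k%:Z &
    8 * K' ^+ 10 * K <= 2 ^+ k.
  by apply: exponent_bound; nra.
rewrite {}/E kE -exprnP addrC in E2 E1 *.
(* Origin of the factors: [K] from recentring, 2K' from the radius 2K'rm^2, K'^2 from the lower
   bound m/K' on [l] at two points, and 2 from the target radius r/2. *)
have {kK} kK : 4 * K' ^+ 3 * K <= 2 ^+ k.
  apply: le_trans kK; rewrite ler_pM2r; last lra.
  have : K' ^+ 3 <= K' ^+ 10 by exact: ler_weXn2l.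
  by lra.
pose A := [set y | [/\ (dl x y <= r%:E)%E, y <> infty, ~ Z y & l y < 2 * L / r]].
(* The ball around [infty] accounts for the summand 1: the inequality l y >= 2L/r means L / l y <=
   r/2. *)
apply: (covered_by_sub (B := qball Z dl infty (r / 2) `|` A) _ (lexx _)).
  move=> y xy; have Zy := ballZ _ xy; rewrite ballE in xy.
  have [->|yi] := pselect (y = infty); first by left; exact: ball_center.
  have [|yL] := ltP (l y) (2 * L / r); first by right.
  left; rewrite /qball memNset //= dly // lee_fin ler_pdivrMr ?l_gt0 //.
  by move: yL; rewrite ler_pdivrMr //; lra.
apply: covered_byU; first exact: (@covered_by1 _ _ _ _ _ infty).
have small m c : 0 < m -> c <> infty ->
    (forall y, A y -> m <= K' * l y /\ e c y <= 2 * K' * r * m ^+ 2) ->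
    covered_by (qball Z dl ^~ (r / 2)) A (D ^+ k).
  move=> m0 ci Am.
  have rho0 : 0 <= 2 * K' * r * m ^+ 2.
    by rewrite !mulr_ge0 ?exprn_ge0 //; lra.
  apply: (covered_by_recentred _ D0 rho0 d_qm d_doubling (c := c)).
  - by lra.
  - by move=> y [].
  - by move=> y [].
  - move=> y Ay; rewrite /qball memNset //=; case: (Ay) => _ yi _ _.
    by rewrite dE // lee_fin; case: (Am y Ay).
  move=> y z Ay Az; have [my _] := Am y Ay; have [mz _] := Am z Az.
  case: Ay Az => _ yi Zy _ [_ zi Zz _].
  rewrite dE // dlE // !lee_fin => eyz.
  rewrite ler_pdivrMr ?mulr_gt0 ?l_gt0 //; apply: le_trans eyz _.
  rewrite mulrA ler_pdivrMr ?exprn_gt0 //.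
  have mm : m ^+ 2 <= K' ^+ 2 * (l y * l z).
    have -> : K' ^+ 2 * (l y * l z) = (K' * l y) * (K' * l z) by ring.
    by rewrite expr2; apply: ler_pM => //; exact: ltW.
  have ll0 : 0 <= r / 2 * (l y * l z).
    by rewrite mulr_ge0 // ltW // mulr_gt0 // l_gt0.
  apply: le_trans (ler_wpM2l ll0 kK).
  have -> : r / 2 * (l y * l z) * (4 * K' ^+ 3 * K) =
    2 * K * K' * r * (K' ^+ 2 * (l y * l z)) by field.
  have -> : K * (2 * K' * r * m ^+ 2) = 2 * K * K' * r * m ^+ 2 by ring.
  by apply: ler_wpM2l => //; rewrite !mulr_ge0 //; lra.
(* Here m = L/r. Any point of [A] serves as centre: both values of [l] are below 2L/r, so [eL]
   bounds the distance by K'L(2L/r) = 2K'rm^2. *)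
have far : (forall y, A y -> L / r <= K' * l y) ->
    covered_by (qball Z dl ^~ (r / 2)) A (D ^+ k).
  move=> Ar; have [[c Ac]|noA] := pselect (exists c, A c); last first.
    apply: covered_by_sub (covered_by0 R _); last exact: exprn_ge0.
    by move=> y Ay; apply: noA; exists y.
  have [_ ci _ cL] := Ac.
  apply: (small (L / r) c) => //; first exact: divr_gt0.
  move=> y Ay; split; first exact: Ar.
  case: Ay => _ yi _ yL; apply: le_trans (eL c y ci yi) _.
  have -> : 2 * K' * r * (L / r) ^+ 2 = K' * (L * (2 * L / r)).
    by field; exact: lt0r_neq0.
  apply: ler_wpM2l; first lra.
  by rewrite ge_max !ler_wpM2l // ltW.
have [xi|xi] := pselect (x = infty).
  apply: far => y [+ yi Zy _]; rewrite xi dly // lee_fin.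
  rewrite ler_pdivrMr ?l_gt0 // ler_pdivrMr // => Ly.
  have := l_gt0 y yi Zy => ly0.
  by rewrite mulrAC; nra.
have lx0 := l_gt0 x xi nZx.
have Ae y : A y -> e x y <= r * (l x * l y).
  by case=> + yi Zy _; rewrite dlE // lee_fin ler_pdivrMr // mulr_gt0 // l_gt0.
have lower y : A y -> Num.min (l x) (L / r) <= K' * l y.
  move=> Ay; have ey := Ae y Ay; case: Ay => _ yi Zy _.
  rewrite ge_min; have := Le x y xi yi; rewrite maxr_pMr; last lra.
  (* If e x y dominates, then L l x <= K' r l x l y, and cancelling l x gives L/r <= K' l y;
     otherwise l x <= K' l y directly. *)
  rewrite le_max => /orP[H|H].
    apply/orP; right; rewrite ler_pdivrMr // -(ler_pM2l lx0).
    rewrite mulrC; apply: le_trans H _.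
    have -> : l x * (K' * l y * r) = K' * (r * (l x * l y)) by ring.
    by apply: ler_wpM2l => //; lra.
  apply/orP; left; rewrite -(ler_pM2l L_gt0) mulrCA.
  exact: H.
have [xr|xr] := leP (l x) (L / r).
  apply: (small (l x) x) => // y Ay.
  split; first by have := lower y Ay; rewrite min_l.
  have ey := Ae y Ay; apply: (le_trans ey).
  (* Membership in [A] gives e x y <= r l x l y <= 2L l x; feeding this into [Le y x] bounds l y by
     a multiple of l x, so the radius becomes quadratic in m = l x. *)
  have ly : l y <= 2 * K' * l x.
    case: Ay => _ yi Zy yL; have ly0 := l_gt0 y yi Zy.
    have eyx : e y x = e x y by rewrite /e (qm_sym d_qm) //; exact: defd.
    have e2 : e x y <= 2 * (L * l x).
      apply: le_trans ey _; rewrite mulrCA [2 * _]mulrA [leRHS]mulrC.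
      apply: ler_wpM2l; first exact: ltW.
      by move: (ltW yL); rewrite ler_pdivlMr // mulrC.
    rewrite -(ler_pM2l L_gt0) (le_trans (Le y x yi xi)) // eyx.
    have -> : L * (2 * K' * l x) = K' * (2 * (L * l x)) by ring.
    apply: ler_wpM2l; first lra.
    by rewrite ge_max e2 /= ler_peMl ?ler1n // mulr_ge0 // ltW.
  have -> : 2 * K' * r * l x ^+ 2 = r * (l x * (2 * K' * l x)) by ring.
  by rewrite !ler_wpM2l // ltW.
apply: far => y /lower; rewrite min_r //; exact: ltW.
Qed.
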